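(* Almost surely, $$\lim_{n\to\infty}\frac{\xi(n)}{\log n}=\lim_{n\to\infty}\frac{\eta(n)}{\log n}=\frac{-1}{\log(2q)}.$$
   Context: Let $0<q<p<1$ with $p+q=1$. Let $X_1,X_2,\dots$ be i.i.d. random variables with $\mathbf P(X_1=1)=p$, $\mathbf P(X_1=-1)=q$, and let $S_0=0$, $S_n=X_1+\dots+X_n$ (simple asymmetric random walk on $\mathbb Z$). For $z\in\mathbb Z$ and $n\ge1$ let $\xi(z,n)=\#\{k:0<k\le n,\ S_k=z\}$ be the local time, and $\xi(z,\infty)=\lim_{n\to\infty}\xi(z,n)$ (finite a.s. since the walk is transient). Define $\xi(n)=\max_{z\in\mathbb Z}\xi(z,n)$ and $\eta(n)=\max_{0\le j\le n}\xi(S_j,\infty)$. $\log$ denotes the natural logarithm. *)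

(* Defs.v *)
From HB Require Import structures.
From mathcomp Require Import all_boot all_order all_algebra.
From mathcomp Require Import all_classical all_reals all_analysis.
Set Implicit Arguments. Unset Strict Implicit. Unset Printing Implicit Defensive.
Import Order.TTheory GRing.Theory Num.Theory.
Import numFieldNormedType.Exports.
Local Open Scope classical_set_scope.
Local Open Scope ring_scope.

Section Walk.
Context {d : measure_display} {T : measurableType d} {R : realType}
  (P : probability T R).

Definition mutually_independent (X : nat -> {RV P >-> R}) : Prop :=
  forall (I : seq nat) (B : nat -> set R),
    uniq I -> (forall i, measurable (B i)) ->
    P (\bigcap_(i in [set` I]) (X i @^-1` B i)) =
    (\prod_(i <- I) P (X i @^-1` B i))%E.

Variable X : nat -> {RV P >-> R}.

(* X i is the step X_{i+1} of the paper; S n = X_1 + ... + X_n. *)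
Definition S (n : nat) (w : T) : R := \sum_(i < n) X i w.

Definition xi (z : R) (n : nat) (w : T) : nat :=
  \sum_(1 <= k < n.+1) (S k w == z : nat).

(* xi(z,oo) = lim_n xi(z,n) (nondecreasing, so the supremum; may be +oo) *)
Definition xi_inf (z : R) (w : T) : \bar R :=
  ereal_sup (range (fun n => ((xi z n w)%:R)%:E)).

Definition xi_max (n : nat) (w : T) : \bar R :=
  ereal_sup (range (fun z : int => ((xi z%:~R n w)%:R)%:E)).

Definition eta_walk (n : nat) (w : T) : \bar R :=
  \big[Order.max/(-oo)%E]_(j < n.+1) xi_inf (S j w) w.

End Walk.

(* Main.v *)
Require Import Defs.
From HB Require Import structures.
From mathcomp Require Import all_boot all_order all_algebra.
From mathcomp Require Import ring lra zify.
From mathcomp Require Import all_classical all_reals all_analysis.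
Set Implicit Arguments. Unset Strict Implicit. Unset Printing Implicit Defensive.
Import Order.TTheory GRing.Theory Num.Theory.
Import numFieldNormedType.Exports.
Local Open Scope classical_set_scope.
Local Open Scope ring_scope.

(** The walk started at [0] returns with probability [2q], so it returns at
    least [m] times with probability [(2q)^m], up to a factor close to [1] per
    return if only returns within a fixed time [l] are counted.  Both halves of
    the theorem follow from Borel-Cantelli along the number [m] of visits.
    Upper bound: if [a * 2q < 1], the probability that some [S_i] with
    [i <= a^m] is revisited [m] times is at most [2 (a * 2q)^m], and the local
    time of a site is at most [1] plus the number of returns after its first
    visit.  Lower bound: for [r] slightly less than [2q], among [m r^-m]
    independent blocks of length [l m], some block returns [m] times to its
    starting point except with probability [e^-m], and if [a r > 1] these
    blocks fit in time [a^m].  Taking [a = exp(1/k)] with [k] on either side of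
    [-1 / ln(2q)] and [m] close to [k ln n] sandwiches [xi(n)] and [eta(n)]. *)

(** * Probabilities of events on finitely many biased bits *)

Section Bernoulli.
Context {R : realFieldType} (p q : R).

(* The probability that [N] i.i.d. bits, [true] with probability [p] and [false]
   with probability [q], satisfy [f]. *)
Fixpoint bern (N : nat) (f : seq bool -> bool) : R :=
  if N is n.+1 then p * bern n (fun s => f (true :: s)) +
                    q * bern n (fun s => f (false :: s))
  else (f [::])%:R.

Lemma eq_bern N f g : f =1 g -> bern N f = bern N g.
Proof.
elim: N f g => [|N IH] f g fg /=; first by rewrite fg.
by congr (_ * _ + _ * _); apply: IH => s; apply: fg.
Qed.

Hypothesis pq1 : p + q = 1.

Lemma bern_cst N b : bern N (fun=> b) = b%:R.
Proof. by elim: N => //= N ->; rewrite -mulrDl pq1 mul1r. Qed.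

Lemma bernC N f : bern N (fun s => ~~ f s) = 1 - bern N f.
Proof.
elim: N f => [|N IH] f /=; first by case: (f _); rewrite ?subrr ?subr0.
rewrite !IH -[in RHS]pq1; ring.
Qed.

(** Independence of two consecutive blocks of bits. *)
Lemma bern_cat L M (g h : seq bool -> bool) :
  bern (L + M) (fun s => g (take L s) && h (drop L s)) = bern L g * bern M h.
Proof.
elim: L g => [|L IH] g; last first.
  rewrite addSn /= (IH (fun s => g (true :: s))) (IH (fun s => g (false :: s))).
  by rewrite mulrDl !mulrA.
rewrite add0n /= (@eq_bern _ _ (fun s => g [::] && h s)) => [|s].
  by case: (g [::]); rewrite ?mul1r// mul0r bern_cst.
by rewrite take0 drop0.
Qed.

Fixpoint all_blocks (g : seq bool -> bool) (L J : nat) (s : seq bool) : bool :=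
  if J is J'.+1 then g (take L s) && all_blocks g L J' (drop L s) else true.

Lemma bern_all_blocks g L J :
  bern (J * L) (all_blocks g L J) = bern L g ^+ J.
Proof.
elim: J => [|J IH]; first by rewrite mul0n.
by rewrite mulSn exprS -IH -bern_cat.
Qed.

Lemma all_blocksP (g : seq bool -> bool) L J s :
  reflect (forall j, (j < J)%N -> g (take L (drop (j * L) s)))
          (all_blocks g L J s).
Proof.
elim: J s => [|J IH] s /=; first by constructor.
apply: (iffP andP) => [[gs /IH H] [|j] jJ|H]; first by rewrite mul0n drop0.
  by rewrite mulSn addnC -drop_drop; exact: H.
split; first by have := H 0%N isT; rewrite mul0n drop0.
by apply/IH => j jJ; rewrite drop_drop addnC -mulSn; exact: H.
Qed.

Hypotheses (p0 : 0 <= p) (q0 : 0 <= q).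

Lemma bern_ge0 N f : 0 <= bern N f.
Proof.
by elim: N f => [|N IH] f /=; rewrite ?ler0n// addr_ge0// mulr_ge0.
Qed.

Lemma bern_le1 N f : bern N f <= 1.
Proof. by rewrite -subr_ge0 -bernC bern_ge0. Qed.

End Bernoulli.

(* Visits to [0] of the walk started at [x], not counting time [0]; the bits
   encode the steps [+1] and [-1]. *)
Fixpoint visits (x : int) (s : seq bool) : nat :=
  if s is b :: s' then
    let y := x + (if b then 1 else -1) in (y == 0) + visits y s'
  else 0%N.

Lemma visits_take x n s : (visits x (take n s) <= visits x s)%N.
Proof. by elim: s n x => [|b s IH] [|n] x //=; rewrite leq_add2l. Qed.

(** * Upper and lower bounds for the number of returns to the origin *)

Section Returns.
Context {R : realFieldType} {p q : R}.
Hypotheses (q0 : 0 < q) (qp : q < p) (pq1 : p + q = 1).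

Let p0 : 0 < p. Proof. exact: lt_trans qp. Qed.
Let q_half : 2 * q < 1. Proof. by move: qp pq1; lra. Qed.
Let p_half : 1 < 2 * p. Proof. by move: qp pq1; lra. Qed.

(* The probability that the walk started at [x] ever sits at [0]. *)
Let hit (x : int) : R := if x <= 0 then 1 else (q / p) ^ x.

(** First-step analysis off the origin, with [(q / p) ^ x] the gambler's ruin solution on the
    positive side. *)
Let hit_harmonic (x : int) : x != 0 -> p * hit (x + 1) + q * hit (x - 1) = hit x.
Proof.
rewrite /hit; case: x => [[//|n]|n] _.
  have -> : ((n.+1 : int) + 1 <= 0 :> int) = false by lia.
  have -> : ((n.+1 : int) <= 0 :> int) = false by lia.
  have -> : (n.+1 : int) + 1 = n.+2 by lia.
  have -> : (n.+1 : int) - 1 = n by lia.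
  have -> : (if (n : int) <= 0 then 1 else (q / p) ^ n) = (q / p) ^+ n.
    by case: n => [|n]; [rewrite expr0|].
  rewrite -!exprnP !exprS; set t := _ ^+ n.
  have -> : p * (q / p * (q / p * t)) + q * t = (q + p) * (q / p * t).
    by field; rewrite gt_eqF.
  by rewrite addrC pq1 mul1r.
have -> : (Negz n + 1 <= 0 :> int) = true by lia.
have -> : (Negz n - 1 <= 0 :> int) = true by lia.
have -> : (Negz n <= 0 :> int) = true by lia.
by rewrite !mulr1.
Qed.

Let hit1 : hit 1 = q / p. Proof. by []. Qed.
Let hitN1 : hit (-1) = 1. Proof. by []. Qed.

Let hit_ge0 x : 0 <= hit x.
Proof.
by rewrite /hit; case: ifP => // _; rewrite exprz_ge0// divr_ge0// ltW.
Qed.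

(** The infinite-horizon probability of at least [m] visits: a first visit, then [m'] returns. From
    [0] the first visit is itself a return, so it has probability [2 * q] instead of [hit 0 = 1]. *)
Let vbound (x : int) (m : nat) : R :=
  if m is m'.+1 then (if x == 0 then 2 * q else hit x) * (2 * q) ^+ m' else 1.

(* [hit] is superharmonic, and each visit to [0] costs a factor [2q]. *)
Lemma bern_visits_le_vbound L m x :
  bern p q L (fun s => (m <= visits x s)%N) <= vbound x m.
Proof.
have vb0 : forall x m, 0 <= vbound x m.
  move=> y [|n] //=; rewrite mulr_ge0 ?exprn_ge0 ?mulr_ge0 ?(ltW q0)//.
  by case: ifP => // _; rewrite ?mulr_ge0 ?(ltW q0).
elim: L m x => [|L IH] [|m] x /=; rewrite ?leq0n ?bern_cst//.
- exact: (vb0 x m.+1).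
- by rewrite !mulr1 pq1.
(* If [y] is [0], the arrival uses up one visit and [m] remain; otherwise all [m.+1] are still to
   come. *)
have step (y : int) : bern p q L (fun s => (m < (y == 0) + visits y s)%N) <=
    hit y * (2 * q) ^+ m.
  have [->|y0] := eqVneq y 0.
    apply: (le_trans (IH m 0)); rewrite /hit lexx mul1r.
    by case: m {IH} => [|m] //=; rewrite exprS.
  have := IH m.+1 y; rewrite /= (negbTE y0); apply: le_trans.
  by rewrite (@eq_bern _ _ _ _ _ (fun s => (m < visits y s)%N)).
apply: (le_trans (lerD (ler_wpM2l (ltW p0) (step _)) (ler_wpM2l (ltW q0) (step _)))).
rewrite !mulrA -mulrDl ler_wpM2r// ?exprn_ge0// ?mulr_ge0 ?(ltW q0)//.
have [->|x0] := eqVneq x 0; last by rewrite hit_harmonic.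
(* From [0] the return probability is [p * (q / p) + q * 1 = 2 * q]. *)
rewrite !add0r hit1 hitN1 mulr1 mulrCA divff ?gt_eqF// mulr1; lra.
Qed.

Lemma bern_visits_le L m :
  bern p q L (fun s => (m <= visits 0 s)%N) <= (2 * q) ^+ m.
Proof.
by apply: (le_trans (bern_visits_le_vbound L m 0)); case: m => //= m; rewrite exprS.
Qed.

(* Any [rho] in ]q/p, 1[ would do: [x |-> rho ^ x] is then an eigenfunction of
   the walk with eigenvalue less than 1, and bounds [hit] for [x > 0]. *)
Let rho : R := (2 * p)^-1.
Let lam : R := 2^-1 + 2 * p * q.

Let rho0 : 0 < rho. Proof. by rewrite invr_gt0 mulr_gt0. Qed.

Let rho_eigen (x : int) : p * rho ^ (x + 1) + q * rho ^ (x - 1) = lam * rho ^ x.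
Proof.
have r0 : rho != 0 by rewrite gt_eqF.
rewrite !expfzDr// mulrCA [q * _]mulrCA -mulrDr mulrC; congr (_ * _).
rewrite expr1z -invr_expz expr1z /rho /lam; field.
by rewrite gt_eqF.
Qed.

(** Off the origin the left side obeys the same one-step recursion as the probability of hitting [0]
    within [L] steps. For [L = 0] it is nonpositive there because [rho ^ x] dominates [hit x]:
    [q / p <= rho] if [x > 0], and [1 <= rho ^ x] if [x < 0]. *)
Let bern_hit_ge L (x : int) :
  hit x - lam ^+ L * rho ^ x <=
  (if x == 0 then 1 else bern p q L (fun s => (0 < visits x s)%N)).
Proof.
have l0 : 0 <= lam by rewrite addr_ge0 ?mulr_ge0 ?invr_ge0 ?ltW.
have r0 : rho != 0 by rewrite gt_eqF.
elim: L x => [|L IH] x; have [->|x0] := eqVneq x 0.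
- by rewrite /hit lexx gerBl mul1r expr0z.
- rewrite /= mul1r subr_le0 /hit; case: x x0 => [[//|n]|n] _.
    rewrite [_ <= 0]lez_nat /= -!exprnP lerXn2r ?nnegrE ?divr_ge0 ?(ltW p0) ?(ltW q0) ?(ltW rho0)//.
    rewrite ler_pdivrMr// /rho invfM -mulrA mulVf ?gt_eqF// mulr1.
    by rewrite -[2^-1]mul1r ler_pdivlMr// mulrC ltW.
  have -> : (Negz n <= 0) by lia.
  by rewrite NegzE -exprz_inv /rho invrK exprn_ege1// ltW.
- rewrite /hit lexx gerBl expr0z mulr1. exact: exprn_ge0.
rewrite -hit_harmonic// exprSr -mulrA -rho_eigen.
have step (y : int) : bern p q L (fun s => (0 < (y == 0%R) + visits y s)%N) =
    (if y == 0 then 1 else bern p q L (fun s => (0 < visits y s)%N)).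
  have [->|y0] := eqVneq y 0; last exact: eq_bern.
  by rewrite (@eq_bern _ _ _ _ _ (fun=> true)) ?bern_cst.
rewrite /= !step.
apply: le_trans (lerD (ler_wpM2l (ltW p0) (IH _)) (ler_wpM2l (ltW q0) (IH _))).
by rewrite le_eqVlt; apply/orP; left; apply/eqP; ring.
Qed.

Lemma lam_lt1 : lam < 1.
Proof.
have pE : p = 1 - q by rewrite -pq1 addrK.
(* The gap [1 - lam] is half of this square. *)
have : 0 < (1 - 2 * q) ^+ 2 by rewrite exprn_gt0// subr_gt0.
by rewrite /lam pE; lra.
Qed.

Lemma lam_ge0 : 0 <= lam.
Proof. by rewrite addr_ge0 ?mulr_ge0 ?invr_ge0 ?ltW. Qed.

(** The first step leads to [1] or [-1]; the two error terms recombine into [lam ^+ L.+1] by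
    [rho_eigen] at [0]. *)
Lemma bern_return_ge L :
  2 * q - lam ^+ L.+1 <= bern p q L.+1 (fun s => (0 < visits 0 s)%N).
Proof.
have := lerD (ler_wpM2l (ltW p0) (bern_hit_ge L 1)) (ler_wpM2l (ltW q0) (bern_hit_ge L (-1))).
rewrite /=; apply: le_trans.
have := rho_eigen 0; rewrite !add0r expr0z mulr1 hit1 hitN1 => e.
rewrite exprSr -[X in _ ^+ _ * X]e le_eqVlt; apply/orP; left; apply/eqP.
set a := lam ^+ L; set b := rho ^ 1; set c := rho ^ (-1).
by field; rewrite gt_eqF.
Qed.

(** The strong Markov property at the first visit to [0]. That visit occurs at a random time up to
    [L], so the bound [c] has to hold for every remaining horizon [M'] from [M] on. *)
Lemma bern_visitsS_ge L M m x c : 0 <= c ->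
  (forall M', (M <= M')%N -> c <= bern p q M' (fun s => (m <= visits 0 s)%N)) ->
  bern p q L (fun s => (0 < visits x s)%N) * c <=
  bern p q (L + M) (fun s => (m < visits x s)%N).
Proof.
move=> c0 Mc; elim: L x => [|L IH] x.
  by rewrite mul0r bern_ge0 ?ltW.
rewrite addSn /= mulrDl -!mulrA.
have step (y : int) :
    bern p q L (fun s => (0 < (y == 0%R) + visits y s)%N) * c <=
    bern p q (L + M) (fun s => (m < (y == 0%R) + visits y s)%N).
  have [->|_] := eqVneq y 0; last exact: IH.
  apply: le_trans (Mc _ (leq_addl _ _)).
  by rewrite ler_piMl// bern_le1 ?ltW.
by apply: lerD; apply: ler_wpM2l; rewrite ?step ?ltW.
Qed.

Lemma bern_visits_ge l m M : (l * m <= M)%N ->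
  bern p q l (fun s => (0 < visits 0 s)%N) ^+ m <=
  bern p q M (fun s => (m <= visits 0 s)%N).
Proof.
elim: m M => [|m IH] M lM; first by rewrite bern_cst.
have lM' : (l <= M)%N by apply: leq_trans lM; rewrite leq_pmulr.
rewrite -(subnKC lM') exprS; apply: bern_visitsS_ge.
  by rewrite exprn_ge0// bern_ge0 ?ltW.
move=> M' MM'; apply: IH; apply: leq_trans MM'.
by rewrite leq_subRL// -mulnS.
Qed.

End Returns.

(** Borel-Cantelli, with summability from a geometric series. *)
Lemma ae_eventually_not {d} {T : measurableType d} {R : realType}
    (P : probability T R) (E : nat -> set T) (C r : R) :
  0 <= C -> 0 < r -> r < 1 -> (forall m, measurable (E m)) ->
  (forall m, (P (E m) <= (C * r ^+ m)%:E)%E) ->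
  {ae P, forall w, exists m0, forall m, (m0 <= m)%N -> ~ E m w}.
Proof.
move=> C0 r0 r1 mE PE; exists (lim_sup_set E); split.
- by apply: bigcap_measurable => // n _; exact: bigcup_measurable.
- apply: lim_sup_set_cvg0 => //.
  apply: (@le_lt_trans _ _ (C / (1 - r))%:E); last exact: ltry.
  apply: lime_le; first exact: is_cvg_nneseries.
  apply: nearW => n; rewrite big_mkord.
  apply: (@le_trans _ _ (\sum_(i < n) (C * r ^+ i)%:E)%E).
    by apply: lee_sum => i _; exact: PE.
  rewrite sumEFin lee_fin; have := @geometric_le_lim R n C r C0 r0.
  rewrite /series/= big_mkord gtr0_norm//; exact.
- move=> w /= H n _ /=; apply: contrapT => nE; apply: H; exists n => m nm Em.
  by apply: nE; exists m.
Qed.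

(** * Transfer from finite bit sequences to the random steps *)

Section Bits.
Context {d} {T : measurableType d} {R : realType} {P : probability T R}.
Context (X : nat -> {RV P >-> R}).

Definition bits (i N : nat) (w : T) : seq bool :=
  [seq X k w == 1 | k <- iota i N].

Lemma bitsS i N w : bits i N.+1 w = (X i w == 1) :: bits i.+1 N w.
Proof. by []. Qed.

Lemma take_bits i N L w : (L <= N)%N -> take L (bits i N w) = bits i L w.
Proof. by move=> LN; rewrite /bits -map_take take_iota (minn_idPl LN). Qed.

Lemma drop_bits i N j w : drop j (bits i N w) = bits (i + j) (N - j) w.
Proof. by rewrite /bits -map_drop drop_iota addnC. Qed.

Context {p q : R}.
Hypotheses (pq1 : p + q = 1) (indX : mutually_independent X)
  (X1 : forall i, P (X i @^-1` [set 1]) = p%:E).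

Let wt (b : bool) : R := if b then p else q.

Let cylinder i (s : seq bool) :
  measurable [set w | bits i (size s) w = s] /\
  P [set w | bits i (size s) w = s] = (\prod_(b <- s) wt b)%:E.
Proof.
(* Each prescribed bit asks for the set of [1] or for its complement, and independence is applied to
   these sets. *)
pose B k := if nth false s (k - i) then [set 1 : R] else ~` [set 1].
have mB k : measurable (B k).
  by rewrite /B; case: ifP => _; [|apply: measurableC]; exact: measurable_set1.
have -> : [set w | bits i (size s) w = s] =
    \bigcap_(k in [set` iota i (size s)]) (X k @^-1` B k).
  apply/seteqP; split=> w /=.
    move=> ws k; rewrite /= mem_iota => /andP[ik ki]; rewrite /B /= -ws.
    rewrite (nth_map 0%N) ?size_iota ?nth_iota ?subnKC//; try lia.
    by case: eqP.
  move=> H; apply: (@eq_from_nth _ false); rewrite size_map size_iota// => k ks.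
  rewrite (nth_map 0%N) ?size_iota// nth_iota//.
  have := H (i + k)%N; rewrite /= mem_iota leq_addr ltn_add2l ks => /(_ isT).
  rewrite /B addKn; case: nth => /= [->|/eqP/negbTE ->//]; exact: eqxx.
split.
  apply: fin_bigcap_measurable => //= k _; exact: measurable_funPTI.
rewrite indX ?iota_uniq// (eq_bigr (fun k => (wt (nth false s (k - i)))%:E)).
  rewrite prodEFin -[X in iota X _]addn0 iotaDl big_map (big_nth false).
  by rewrite /index_iota subn0; under eq_bigr do rewrite addKn.
move=> k _; rewrite /B; case: nth => /=; first exact: X1.
rewrite -preimage_setC probability_setC ?X1; last exact: measurable_funPTI.
by rewrite -EFinB -pq1 addrAC subrr add0r.
Qed.

Lemma probability_bits i N (f : seq bool -> bool) :
  measurable [set w | f (bits i N w)] /\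
  P [set w | f (bits i N w)] = (bern p q N f)%:E.
Proof.
(* [bern] splits off one bit at a time, so the induction on [N] carries the bits already read as a
   prefix [s]; independence is used only at the end, on a full cylinder. *)
suff H s : measurable [set w | bits i (size s) w = s /\
                               f (bits (i + size s) N w)] /\
    P [set w | bits i (size s) w = s /\ f (bits (i + size s) N w)] =
    ((\prod_(b <- s) wt b) * bern p q N f)%:E.
  have := H [::]; rewrite big_nil mul1r /= addn0.
  suff -> : [set w | bits i 0 w = [::] /\ f (bits i N w)] =
            [set w | f (bits i N w)] by [].
  by apply/seteqP; split => w /=; [case|].
elim: N f s => [|N IH] f s.
  rewrite /bits /=; case: (f [::]).
    have [mc Pc] := cylinder i s; rewrite mulr1 -Pc.
    suff -> : [set w | [seq X k w == 1 | k <- iota i (size s)] = s /\ true] =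
      [set w | bits i (size s) w = s] by [].
    by apply/seteqP; split => w /=; [case|].
  rewrite mulr0 (_ : [set w | _] = set0) ?measure0//.
  by apply/seteqP; split => w //= [].
pose A b := [set w | bits i (size (rcons s b)) w = rcons s b /\
                     f (b :: bits (i + size (rcons s b)) N w)].
have -> : [set w | bits i (size s) w = s /\ f (bits (i + size s) N.+1 w)] =
    A true `|` A false.
  have e w : bits i (size s).+1 w = rcons (bits i (size s) w) (X (i + size s)%N w == 1).
    by rewrite /bits -addn1 iotaD map_cat cats1.
  apply/seteqP; split => w; rewrite /A /= !size_rcons e addnS.
    by move=> [ws]; rewrite ws bitsS; case: (_ == _) => ?; [left|right].
  by rewrite bitsS; case=> -[/rcons_inj[-> ->]].
have [[mA PA] [mA' PA']] := (IH (fun s => f (true :: s)) (rcons s true),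
  IH (fun s => f (false :: s)) (rcons s false)).
split; first exact: measurableU.
have -> : P (A true `|` A false) = (P (A true) + P (A false))%E.
  apply: measureU => //; apply/seteqP; split => w //=.
  by rewrite /A /= !size_rcons => -[[-> _] [/rcons_inj[]]].
rewrite (PA : P (A true) = _) (PA' : P (A false) = _) !big_rcons /= -EFinD.
by congr _%:E; rewrite /wt; ring.
Qed.

End Bits.

(** From the cubic term of the exponential series. It lets the blocks of the lower bound, of total
    length of order [m ^ 2 / r ^ m], fit in time [a ^ m]. *)
Lemma square_le_exprn {R : realType} (C t : R) : 0 <= C -> 1 < t ->
  exists m0, forall m, (m0 <= m)%N -> C * m%:R ^+ 2 <= t ^+ m.
Proof.
move=> C0 t1; have t0 : 0 < ln t by rewrite ln_gt0.
have T0 : 0 < ln t ^+ 3 by rewrite exprn_gt0.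
exists (Num.truncn (6 * C / ln t ^+ 3)).+1 => m; rewrite truncn_lt_nat; last first.
  by rewrite divr_ge0 ?mulr_ge0// ltW.
rewrite ltr_pdivrMr// => /ltW Cm.
rewrite -[t]lnK ?posrE ?(lt_trans ltr01)// -expRM_natr.
apply: le_trans (@expR_ge1Dxn R (ln t * m%:R) 2 _); last first.
  by rewrite mulr_ge0 ?ler0n// ltW.
apply: ler_wpDl => //; rewrite ler_pdivlMr ?ltr0n ?fact_gt0//.
have -> : (3`!)%:R = 6 :> R by [].
have -> : (ln t * m%:R) ^+ 3 = m%:R * ln t ^+ 3 * m%:R ^+ 2 by ring.
have -> : C * m%:R ^+ 2 * 6 = 6 * C * m%:R ^+ 2 by ring.
by rewrite ler_wpM2r// sqr_ge0.
Qed.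

(** * Almost sure bounds on visits along the number [m] of visits *)

Section AlmostSure.
Context {d} {T : measurableType d} {R : realType} (P : probability T R).
Context {p q : R} {X : nat -> {RV P >-> R}}.
Hypotheses (q0 : 0 < q) (qp : q < p) (pq1 : p + q = 1).
Hypotheses (indX : mutually_independent X)
  (X1 : forall i, P (X i @^-1` [set 1]) = p%:E).

Let p0 : 0 < p. Proof. exact: lt_trans qp. Qed.
Let q2 : 0 < 2 * q. Proof. by rewrite mulr_gt0. Qed.

(** The events increase with [L], so continuity from below carries the uniform finite-horizon bound
    to the union. *)
Lemma probability_visits_le i m :
  measurable [set w | exists L, (m <= visits 0 (bits X i L w))%N] /\
  (P [set w | exists L, (m <= visits 0 (bits X i L w))%N] <= ((2 * q) ^+ m)%:E)%E.
Proof.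
pose F L := [set w | (m <= visits 0 (bits X i L w))%N].
have FP := probability_bits pq1 indX X1 i _ (fun s => (m <= visits 0 s)%N).
have -> : [set w | exists L, (m <= visits 0 (bits X i L w))%N] = \bigcup_L F L.
  by apply/seteqP; split => w [L] => [|_] mL; exists L.
have mF L : measurable (F L) by have [] := FP L.
have mUF : measurable (\bigcup_L F L) by exact: bigcup_measurable.
split => //; have ndF : nondecreasing_seq F.
  move=> L M LM; apply/subsetPset => w; rewrite /F /= => /leq_trans; apply.
  by rewrite -(take_bits X i w LM) visits_take.
have cF := @nondecreasing_cvg_mu _ _ _ P _ mF mUF ndF.
rewrite -(cvg_lim _ cF)//; apply: lime_le; first by apply/cvg_ex; eexists; exact: cF.
apply: nearW => L; have [_ ] := FP L; rewrite /F /= => ->.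
by rewrite lee_fin bern_visits_le.
Qed.

Lemma ae_visits_lt (a : R) : 1 <= a -> a * (2 * q) < 1 ->
  {ae P, forall w, exists m0, forall m, (m0 <= m)%N ->
     forall i L, i%:R <= a ^+ m -> (visits 0 (bits X i L w) < m)%N}.
Proof.
move=> a1 aq; have a0 : 0 < a by exact: lt_le_trans a1.
pose F m i := [set w | exists L, (m <= visits 0 (bits X i L w))%N].
pose n m := (Num.truncn (a ^+ m)).+1.
pose E m := \big[setU/set0]_(i < n m) F m i.
have mF m i : measurable (F m i) by have [] := probability_visits_le i m.
have mE m : measurable (E m) by exact: bigsetU_measurable.
(* Union bound over at most [a ^ m + 1] starting times; [1 <= a ^ m] gives the factor 2. *)
have PE m : (P (E m) <= (2 * (a * (2 * q)) ^+ m)%:E)%E.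
  apply: (le_trans (@Boole_inequality _ _ _ P (F m) (n m) _)) => //.
  apply: (@le_trans _ _ (\sum_(i < n m) ((2 * q) ^+ m)%:E)%E).
    by apply: lee_sum => i _; have [] := probability_visits_le i m.
  rewrite sumEFin lee_fin sumr_const card_ord [in leRHS]exprMn mulrA -[leLHS]mulr_natl.
  rewrite ler_wpM2r ?exprn_ge0 ?(ltW q2)// /n -natr1 mulrDl mul1r lerD//.
    by rewrite truncn_le exprn_ge0// ltW.
  by rewrite exprn_ege1.
have := ae_eventually_not (ler0n R 2) (mulr_gt0 a0 q2) aq mE PE.
apply: filterS => w [m0 Hm0]; exists m0 => m /Hm0 nE i L im; rewrite ltnNge.
apply/negP => mL; apply: nE; rewrite /E -bigcup_mkord; exists i => /=; last by exists L.
by rewrite /n ltnS truncn_ge_nat// exprn_ge0// ltW.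
Qed.

(** The return probability within [l] steps is at least [2 * q - lam ^ l], which exceeds [a^-1] for
    large [l]. *)
Let exists_bern_return_gt (a : R) : 0 < a -> 1 < a * (2 * q) ->
  exists l, 1 < a * bern p q l (fun s => (0 < visits 0 s)%N).
Proof.
move=> a0 aq; pose lam : R := 2^-1 + 2 * p * q.
have lam1 : lam < 1 := lam_lt1 qp pq1.
have lam0 : 0 <= lam := lam_ge0 q0 qp.
have e0 : 0 < 2 * q - a^-1 by rewrite subr_gt0 invf_plt ?posrE// -[_^-1]mul1r ltr_pdivrMr.
have : lam ^+ n @[n --> \oo] --> (0 : R) by apply: cvg_expr; rewrite ger0_norm.
move=> /cvgrPdist_lt /(_ _ e0)[n _ /(_ n.+1 (leqnSn n))].
rewrite sub0r normrN ger0_norm ?exprn_ge0// => lamn; exists n.+1.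
have := bern_return_ge q0 qp pq1 n; rewrite -/lam => H.
rewrite mulrC -ltr_pdivrMr// mul1r; apply: lt_le_trans H.
by rewrite ltrBrDl addrC -ltrBrDl.
Qed.

Lemma ae_visits_ge (a : R) : 0 < a -> 1 < a * (2 * q) ->
  {ae P, forall w, exists m0, forall m, (m0 <= m)%N ->
     exists i L, (i + L)%:R <= a ^+ m /\ (m <= visits 0 (bits X i L w))%N}.
Proof.
move=> a0 aq; have [l arl] := exists_bern_return_gt a0 aq.
set r := bern p q l _ in arl.
have r0 : 0 < r by rewrite -(pmulr_rgt0 _ a0) (lt_trans ltr01).
have r1 : r <= 1 by rewrite bern_le1 ?ltW.
(* More than [m / r ^ m] blocks, so that [(1 - r ^ m) ^ J] is at most
   [exp (- r ^ m * J) <= exp (- m)]. *)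
pose J m := (Num.truncn (m%:R / r ^+ m)).+1.
pose g m s := ~~ (m <= visits 0 s)%N.
pose E m := [set w | all_blocks (g m) (l * m) (J m) (bits X 0 (J m * (l * m)) w)].
have EP m := probability_bits pq1 indX X1 0 (J m * (l * m)) (all_blocks (g m) (l * m) (J m)).
have mE m : measurable (E m) by have [] := EP m.
have PE m : (P (E m) <= (1 * expR (-1) ^+ m)%:E)%E.
  have [_ ] := EP m; rewrite -/(E m) => ->; rewrite lee_fin mul1r.
  rewrite bern_all_blocks// bernC//.
  have rm : 0 < r ^+ m by rewrite exprn_gt0.
  have rm1 : 0 <= 1 - r ^+ m by rewrite subr_ge0 exprn_ile1// ltW.
  apply: (@le_trans _ _ ((1 - r ^+ m) ^+ J m)).
    apply: lerXn2r; rewrite ?nnegrE// ?subr_ge0 ?bern_le1 ?(ltW p0) ?(ltW q0)//.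
    by rewrite lerD2l lerN2 bern_visits_ge.
  apply: (@le_trans _ _ (expR (- r ^+ m) ^+ J m)).
    apply: lerXn2r; rewrite ?nnegrE ?expR_ge0//.
    exact: expR_ge1Dx.
  rewrite -!expRM_natl ler_expR mulrN1 mulrN lerN2 -ler_pdivrMr//.
  by rewrite ltW// truncnS_gt.
(* Since [J m * r ^ m <= m + r ^ m <= 2 * m] for [m >= 1], the total length [J m * (l * m)] times
   [r ^ m] is at most [2 * l * m ^ 2], to be compared with [(a * r) ^ m]. *)
have [m1 Hm1] := square_le_exprn (mulr_ge0 (ler0n R 2) (ler0n R l)) arl.
have e1 : expR (-1) < 1 :> R by rewrite expR_lt1 oppr_lt0.
have := ae_eventually_not ler01 (expR_gt0 _) e1 mE PE.
apply: filterS => w [m0 Hm0]; exists (maxn 1 (maxn m0 m1)) => m.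
rewrite !geq_max => /and3P[m_gt0 /Hm0 nE /Hm1 H].
have [j jJ nv] : exists2 j, (j < J m)%N & (m <= visits 0 (bits X (j * (l * m)) (l * m) w))%N.
  apply: contrapT => nex; apply: nE; apply: (introT (all_blocksP _ _ _ _)) => j jJ.
  rewrite drop_bits -mulnBl take_bits; last by rewrite leq_pmull// subn_gt0.
  by apply/negP => mv; apply: nex; exists j.
exists (j * (l * m))%N, (l * m)%N; split => //.
have rm : 0 < r ^+ m by rewrite exprn_gt0.
have jlm : (j * (l * m) + l * m <= J m * (l * m))%N by rewrite -mulSnr leq_mul2r jJ orbT.
have : (j * (l * m) + l * m)%:R <= (J m * (l * m))%:R :> R by rewrite ler_nat.
move/le_trans; apply; rewrite exprMn in H.
rewrite -(ler_pM2r rm); apply: le_trans H.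
have -> : 2 * l%:R * m%:R ^+ 2 = (m%:R + m%:R) * (l * m)%:R :> R by rewrite natrM; ring.
rewrite natrM mulrAC ler_wpM2r ?ler0n// /J -natr1 mulrDl mul1r lerD//.
  rewrite -ler_pdivlMr// truncn_le divr_ge0 ?ler0n ?ltW//.
apply: (@le_trans _ _ 1); first by rewrite exprn_ile1 ?(ltW r0).
by rewrite ler1n.
Qed.

End AlmostSure.

(** * Visits, local times and their maxima along a fixed path *)

Section Pathwise.
Context {d} {T : measurableType d} {R : realType} {P : probability T R}.
Context {X : nat -> {RV P >-> R}} {w : T}.
Hypothesis X11 : forall k, X k w = 1 \/ X k w = -1.

Lemma S_succ k : S X k.+1 w = S X k w + X k w.
Proof. by rewrite /S big_ord_recr. Qed.

Lemma S_int k : exists z : int, S X k w = z%:~R.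
Proof.
elim: k => [|k [z zE]]; first by exists 0; rewrite /S big_ord0.
by rewrite S_succ zE; case: (X11 k) => ->; [exists (z + 1)|exists (z - 1)];
  rewrite ?intrB ?intrD.
Qed.

Lemma visits_bits i L :
  visits 0 (bits X i L w) =
  (\sum_(i.+1 <= k < (i + L).+1) (S X k w == S X i w : nat))%N.
Proof.
(* A general starting point [x] lets the induction on [L] absorb the first step into it. *)
suff H x : visits x (bits X i L w) =
    (\sum_(i.+1 <= k < (i + L).+1) ((x%:~R + S X k w)%R == S X i w : nat))%N.
  by rewrite H; apply: eq_bigr => k _; rewrite add0r.
elim: L i x => [|L IH] i x; first by rewrite addn0 big_geq.
rewrite bitsS big_ltn ?ltnS ?addnS ?leq_addr//= IH addSn.
set y := (x + _)%R.
have xy : y%:~R = x%:~R + X i w :> R.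
  rewrite /y; case: (X11 i) => ->; rewrite ?eqxx ?intrD//.
  by have -> : (-1 == 1 :> R) = false by rewrite lt_eqF// gtrN.
congr (_ + _)%N.
  have -> : (x%:~R + S X i.+1 w == S X i w) = (x%:~R + X i w == 0).
    by rewrite S_succ -subr_eq0 addrCA addrAC subrr add0r.
  by rewrite -xy intr_eq0.
apply: eq_bigr => k _; congr (nat_of_bool _).
by rewrite xy S_succ addrAC (inj_eq (addIr _)).
Qed.

Lemma visits_le_xi_max i L n : (i + L <= n)%N ->
  ((visits 0 (bits X i L w))%:R%:E <= xi_max X n w)%E.
Proof.
move=> iLn; have [z zE] := S_int i.
apply: (@le_trans _ _ ((xi X z%:~R n w)%:R%:E)); last first.
  by apply: ereal_sup_ubound; exists z.
rewrite lee_fin ler_nat visits_bits /xi zE.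
rewrite (@big_cat_nat _ _ _ i.+1 1 n.+1)//= ?ltnS; last by lia.
rewrite (@big_cat_nat _ _ _ (i + L).+1 i.+1 n.+1)//= ?ltnS ?leq_addr//.
by rewrite addnCA leq_addr.
Qed.

Lemma xi_le_xi_inf z n : ((xi X z n w)%:R%:E <= xi_inf X z w)%E.
Proof. by apply: ereal_sup_ubound; exists n. Qed.

Lemma xi_inf_le_eta j n : (j <= n)%N -> (xi_inf X (S X j w) w <= eta_walk X n w)%E.
Proof.
rewrite -ltnS => jn; pose F (j : 'I_n.+1) := xi_inf X (S X j w) w.
exact: (le_bigmax _ F (Ordinal jn)).
Qed.

(** A site with positive local time is [S k] for some [k <= n]; a site with local time zero is
    compared with [S 0]. *)
Lemma xi_max_le_eta n : (xi_max X n w <= eta_walk X n w)%E.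
Proof.
apply: ge_ereal_sup => _ [z _ <-].
have [x0|] := posnP (xi X z%:~R n w).
  rewrite x0; apply: le_trans (xi_inf_le_eta (leq0n n)).
  by apply: le_trans (xi_le_xi_inf _ 0); rewrite lee_fin ler_nat.
rewrite lt0n /xi sum_nat_seq_neq0 => /hasP[k].
rewrite mem_index_iota ltnS => /andP[_ kn]; rewrite /= eqb0 negbK => /eqP Skz.
by rewrite -Skz; apply: le_trans (xi_inf_le_eta kn); exact: xi_le_xi_inf.
Qed.

(* All visits to [S j] occur at or after the time [i] of the first one. *)
Lemma eta_le_visits n m :
  (forall i L, (i <= n)%N -> (visits 0 (bits X i L w) < m)%N) ->
  (eta_walk X n w <= m%:R%:E)%E.
Proof.
move=> H; apply: bigmax_le; first exact: leNye.
move=> [j /= jn] _; apply: ge_ereal_sup => _ [N _ <-]; rewrite lee_fin ler_nat.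
have exi : exists i, S X i w == S X j w by exists j.
case: (ex_minnP exi) => i /eqP Si imin; rewrite -Si /xi.
have ij : (i <= j)%N by exact: imin.
have xi0 a : (\sum_(1 <= k < a.+1 | (k < i)%N) (S X k w == S X i w : nat) = 0)%N.
  apply: big1 => k ki; rewrite Si; case: eqP => // /eqP /imin.
  by rewrite leqNgt ki.
have := H i (N - i)%N (leq_trans ij jn); rewrite visits_bits; apply: leq_trans.
rewrite (bigID (fun k => k < i)%N) /= xi0 add0n.
have [iN|Ni] := leqP i N; last first.
  rewrite big_nat_cond big_pred0 ?ltn0Sn// => k; rewrite -leqNgt.
  by apply/negP => /andP[/andP[_ kN] ik]; lia.
rewrite subnKC//.
(* Local time does not count time [0]: for [i = 0] it is just the number of returns, for [i > 0] the
   first visit adds one. *)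
case: i {exi imin ij xi0 H} Si iN => [|i] Si iN.
  exact: leqnSn.
rewrite (@leq_trans (1 + \sum_(i.+2 <= k < N.+1) (S X k w == S X i.+1 w)))//.
rewrite (@big_cat_nat _ _ _ i.+1 1 N.+1)//=; last exact: ltnW.
rewrite big_nat_cond big_pred0 ?add0n; last by move=> k; lia.
rewrite big_ltn_cond ?ltnS// ltnn /= leq_add ?leq_b1//.
by rewrite big_mkcond leq_sum// => k _; case: ifP.
Qed.

End Pathwise.

(** * From logarithmic bounds to the limit *)

Lemma near_ge_ln {R : realType} (K : R) : \forall n \near \oo, K <= ln n%:R.
Proof.
apply: filterS (nbhs_infty_ger (expR K)) => n Kn.
by rewrite -[K]expRK ler_ln ?posrE ?expR_gt0// (lt_le_trans (expR_gt0 K)).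
Qed.

(** After division by [ln n], the slack [c / k.+2] is at most [e / 2] for a suitable [k], and the
    additive 1 contributes at most [e / 2] for large [n]. The bounds also make [f n] eventually
    finite. *)
Lemma cvg_div_ln {R : realType} (f : nat -> \bar R) (c : R) : 0 < c ->
  (forall k : nat, \forall n \near \oo,
     ((c * (1 - k.+2%:R^-1) * ln n%:R - 1)%:E <= f n)%E) ->
  (forall k : nat, \forall n \near \oo,
     (f n <= (c * (1 + k.+2%:R^-1) * ln n%:R + 1)%:E)%E) ->
  (fun n => (f n / (ln n%:R)%:E)%E) @ \oo --> c%:E.
Proof.
move=> c0 lo up; pose g n := fine (f n) / ln n%:R.
have fE : \forall n \near \oo, f n = (fine (f n))%:E.
  apply: filterS2 (lo 0) (up 0) => n ln1 ln2.
  by rewrite fineK// fin_numElt (lt_le_trans (ltNyr _) ln1) (le_lt_trans ln2 (ltry _)).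
apply: cvg_EFin.
  apply: filterS2 fE (near_ge_ln 1) => n -> ln1.
  by rewrite inver gt_eqF ?(lt_le_trans ltr01 ln1).
apply/cvgrPdist_le => e e0; have e20 : 0 < e / 2 by rewrite divr_gt0.
pose k := Num.truncn (c / (e / 2)).
have ke : c * k.+2%:R^-1 <= e / 2.
  rewrite ler_pdivrMr// mulrC -ler_pdivrMr// ltW// (lt_le_trans (truncnS_gt _))//.
  by rewrite ler_nat.
near=> n.
have fn : f n = (fine (f n))%:E by near: n.
have L0 : Num.max 1 (e / 2)^-1 <= ln n%:R by near: n; exact: near_ge_ln.
move: L0; rewrite ge_max => /andP[L1 Le].
have L0 : 0 < ln n%:R :> R by exact: lt_le_trans L1.
rewrite /= fn inver gt_eqF//= ler_distlC.
have {Le} Le : 1 <= e / 2 * ln n%:R by rewrite mulrC -ler_pdivrMr// mul1r.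
have kL : c * k.+2%:R^-1 * ln n%:R <= e / 2 * ln n%:R by rewrite ler_wpM2r// ltW.
have lon : c * (1 - k.+2%:R^-1) * ln n%:R - 1 <= fine (f n).
  by rewrite -lee_fin -fn; near: n; exact: lo.
have upn : fine (f n) <= c * (1 + k.+2%:R^-1) * ln n%:R + 1.
  by rewrite -lee_fin -fn; near: n; exact: up.
rewrite ler_pdivlMr// ler_pdivrMr//.
move: Le kL lon upn; set x := ln _; set y := k.+2%:R^-1; set z := fine _.
move=> Le kL lon upn; apply/andP; split.
  by apply: le_trans lon; lra.
by apply: (le_trans upn); lra.
Unshelve. all: by end_near.
Qed.

Theorem theorem3p1 (d : measure_display) (T : measurableType d) (R : realType)
  (P : probability T R) (p q : R) (X : nat -> {RV P >-> R}) :
  0 < q -> q < p -> p < 1 -> p + q = 1 ->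
  mutually_independent X ->
  (forall i, P (X i @^-1` [set 1]) = p%:E) ->
  (forall i, P (X i @^-1` [set -1]) = q%:E) ->
  {ae P, forall w,
     ((fun n : nat => (xi_max X n w / (ln n%:R)%:E)%E) @ \oo -->
        ((-1) / ln (2 * q))%:E) /\
     ((fun n : nat => (eta_walk X n w / (ln n%:R)%:E)%E) @ \oo -->
        ((-1) / ln (2 * q))%:E)}.
Proof.
move=> q0 qp p1 pq1 indX X1 XN1.
have q2 : 0 < 2 * q by rewrite mulr_gt0.
have q21 : 2 * q < 1 by lra.
pose c : R := -1 / ln (2 * q).
have cE : c^-1 = - ln (2 * q) by rewrite /c invf_div invrN1 mulrN1.
have c0 : 0 < c by rewrite -invr_gt0 cE oppr_gt0 ln_lt0// q2.
(* For [a = expR k], the product [a * (2 * q)] lies above or below 1 according to whether [k] lies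
   above or below [c^-1]. *)
have base k : expR k * (2 * q) = expR (k - c^-1).
  by rewrite cE opprK expRD lnK.
have invk k : (0 < k.+2%:R^-1 :> R) && (k.+2%:R^-1 < 1 :> R).
  by rewrite invr_gt0 ltr0n /= invf_lt1 ?ltr1n ?ltr0n.
(* [k.+2] keeps [lo k] positive even for [k = 0]. *)
pose lo k := c * (1 - k.+2%:R^-1); pose up k := c * (1 + k.+2%:R^-1).
have lo0 k : 0 < lo k by have /andP[? ?] := invk k; rewrite mulr_gt0// subr_gt0.
have up0 k : 0 < up k by have /andP[? ?] := invk k; rewrite mulr_gt0// addr_gt0.
have ae_step : {ae P, forall w, forall k, X k w = 1 \/ X k w = -1}.
  apply: ae_foralln => k.
  pose V (r : R) := X k @^-1` [set r].
  have mV r : measurable (V r) by exact: measurable_funPTI.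
  have mU : measurable (V 1 `|` V (-1)) by exact: measurableU.
  have PU : P (V 1 `|` V (-1)) = (P (V 1%R) + P (V (-1)%R))%E.
    apply: measureU => //; apply/seteqP; split => w //; rewrite /V /= => -[-> /eqP].
    by rewrite gt_eqF// gtrN.
  have PUC : P (~` (V 1 `|` V (-1))) = 0.
    by rewrite probability_setC// PU /V X1 XN1 -EFinD pq1 subrr.
  by exists (~` (V 1 `|` V (-1))); split => //; first exact: measurableC.
have ae_lo : {ae P, forall w, forall k, exists m0, forall m, (m0 <= m)%N ->
    exists i L, (i + L)%:R <= expR (lo k)^-1 ^+ m /\
                (m <= visits 0 (bits X i L w))%N}.
  apply: ae_foralln => k; apply: (ae_visits_ge q0 qp pq1 indX X1 (expR_gt0 _)).
  rewrite base expR_gt1 subr_gt0 ltf_pV2 ?posrE//.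
  by rewrite gtr_pMr// gtrBl; case/andP: (invk k).
have ae_up : {ae P, forall w, forall k, exists m0, forall m, (m0 <= m)%N ->
    forall i L, i%:R <= expR (up k)^-1 ^+ m -> (visits 0 (bits X i L w) < m)%N}.
  apply: ae_foralln => k; apply: (ae_visits_lt q0 qp pq1 indX X1).
    by rewrite -expR0 ler_expR invr_ge0 ltW.
  rewrite base expR_lt1 subr_lt0 ltf_pV2 ?posrE//.
  by rewrite ltr_pMr// ltrDl; case/andP: (invk k).
apply: filterS3 ae_step ae_lo ae_up => w X11 Hlo Hup.
have xi_lo k : \forall n \near \oo, ((lo k * ln n%:R - 1)%:E <= xi_max X n w)%E.
  have [m0 Hm] := Hlo k; near=> n.
  have n0 : 0 < n%:R :> R by rewrite ltr0n; near: n; exact: nbhs_infty_gt.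
  have m0n : m0%:R / lo k <= ln n%:R by near: n; exact: near_ge_ln.
  rewrite ler_pdivrMr// mulrC in m0n.
  have xn0 : 0 <= lo k * ln n%:R by apply: le_trans m0n.
  (* Rounding down gives [m <= lo k * ln n], that is [a ^ m <= n] for [a = expR (lo k)^-1]. *)
  have [|i [L [iL mv]]] := Hm (Num.truncn (lo k * ln n%:R)).
    by rewrite truncn_ge_nat.
  apply: (@le_trans _ _ ((Num.truncn (lo k * ln n%:R))%:R%:E)).
    by rewrite lee_fin lerBlDr natr1 ltW// truncnS_gt.
  apply: le_trans (visits_le_xi_max X11 (i := i) (L := L) _).
    by rewrite lee_fin ler_nat.
  rewrite -(ler_nat R) (le_trans iL)// -expRM_natr -[leRHS]lnK ?posrE// ler_expR.
  by rewrite mulrC ler_pdivrMr// [leRHS]mulrC truncn_le.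
have eta_up k : \forall n \near \oo, (eta_walk X n w <= (up k * ln n%:R + 1)%:E)%E.
  have [m0 Hm] := Hup k; near=> n.
  have n0 : 0 < n%:R :> R by rewrite ltr0n; near: n; exact: nbhs_infty_gt.
  have m0n : m0%:R / up k <= ln n%:R by near: n; exact: near_ge_ln.
  rewrite ler_pdivrMr// mulrC in m0n.
  have xn0 : 0 <= up k * ln n%:R by apply: le_trans m0n.
  (* Here [m] is rounded up past [up k * ln n], so that [n <= a ^ m] for [a = expR (up k)^-1]. *)
  apply: (@le_trans _ _ ((Num.truncn (up k * ln n%:R)).+1%:R%:E)); last first.
    by rewrite lee_fin -natr1 lerD2r truncn_le.
  apply: (eta_le_visits X11) => i L iln; apply: Hm.
    by rewrite leqW// truncn_ge_nat.
  apply: (@le_trans _ _ n%:R); first by rewrite ler_nat.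
  rewrite -expRM_natr -[leLHS]lnK ?posrE// ler_expR.
  by rewrite mulrC ler_pdivlMr// [leLHS]mulrC ltW// truncnS_gt.
(* The lower bound for [xi_max] and the upper bound for [eta_walk] serve both limits, as
   [xi_max <= eta_walk]. *)
split; apply: (@cvg_div_ln _ _ c c0) => k; first exact: xi_lo.
- by apply: filterS (eta_up k) => n; apply: le_trans; exact: xi_max_le_eta.
- by apply: filterS (xi_lo k) => n /le_trans; apply; exact: xi_max_le_eta.
- exact: eta_up.
Unshelve. all: by end_near.
Qed.
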